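(* Let $(X,d_X)$ and $(Y,d_Y)$ be metric spaces and $f:X\to Y$ a continuous function on $X$. Suppose there exist $p,x\in X$ such that $\beta:=d_Y(f(x),f(p))>0$ and there exists a path in $X$ connecting $p$ and $x$. If for every $\epsilon$ with $0<\epsilon\leq\beta$ the open balls $B(p,\delta(p,\epsilon))$ and $B(x,\delta(x,\epsilon))$ are path-connected, then (for every such $\epsilon$) the numbers $\delta(p,\epsilon)$ and $\delta(x,\epsilon)$ are delta-epsilon numbers for $f$ at $p$ and at $x$, respectively.
   Context: For $q\in X$ and $\epsilon>0$, $\delta(q,\epsilon)=\mathrm{dist}(q,f^{-1}(S[f(q),\epsilon]))$, where $S[y_0,\epsilon]=\{y\in Y: d_Y(y_0,y)=\epsilon\}$ and $\mathrm{dist}(q,A)=\inf\{d_X(q,z): z\in A\}$ for nonempty $A\subset X$ (under the hypotheses on $p,x$ in the claim, the relevant preimages are nonempty for $0<\epsilon\le\beta$). $B(q,r)=\{z\in X: d_X(z,q)<r\}$. A path connecting $p$ and $x$ is a continuous map $\gamma:[0,1]\to X$ with $\gamma(0)=p$, $\gamma(1)=x$. A positive number $\delta$ is a delta-epsilon number for $f$ at $q$ (for the given $\epsilon$) if for all $z\in X$, $d_X(z,q)<\delta$ implies $d_Y(f(z),f(q))<\epsilon$. *)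

(* Defs.v *)
From HB Require Import structures.
From mathcomp Require Import all_boot all_order all_algebra.
From mathcomp Require Import all_classical all_reals all_analysis.

Set Implicit Arguments.
Unset Strict Implicit.
Unset Printing Implicit Defensive.

Import Order.TTheory GRing.Theory Num.Theory.

Local Open Scope classical_set_scope.
Local Open Scope ring_scope.

Definition metric_sphere (R : realType) (Y : metricType R) (y0 : Y) (eps : R) :
  set Y := [set y | mdist y0 y = eps].

(* The distance from a point to a set; only meaningful for nonempty [A], since
   [inf set0 = 0]. *)
Definition dist_to_set (R : realType) (X : metricType R) (q : X) (A : set X) :
  R := inf [set mdist q z | z in A].

Definition delta_of (R : realType) (X Y : metricType R) (f : X -> Y) (q : X)
  (eps : R) : R := dist_to_set q (f @^-1` metric_sphere (f q) eps).

(* Only the restriction of [g] to the unit interval matters: [g] is total on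
   [R], and its continuity is that of the restriction. *)
Definition is_path (R : realType) (T : topologicalType) (a b : T) (g : R -> T) :
  Prop := [/\ {within `[0, 1], continuous g}, g 0 = a & g 1 = b].

(* [R] cannot be inferred from [T]; it supplies the unit interval. *)
Definition path_connected (R : realType) (T : topologicalType) (A : set T) :
  Prop :=
  forall a b : T, A a -> A b ->
    exists2 g : R -> T, is_path a b g & g @` `[0, 1] `<=` A.

Definition is_delta_epsilon (R : realType) (X Y : metricType R) (f : X -> Y)
  (q : X) (eps delta : R) : Prop :=
  0 < delta /\ forall z : X, mdist z q < delta -> mdist (f z) (f q) < eps.

(* Main.v *)
Require Import Defs.
From HB Require Import structures.
From mathcomp Require Import all_boot all_order all_algebra.
From mathcomp Require Import all_classical all_reals all_analysis.

Import Order.TTheory GRing.Theory Num.Theory.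
Import numFieldNormedType.Exports.

Local Open Scope classical_set_scope.
Local Open Scope ring_scope.

(** The intermediate value theorem along paths is used twice, through
    [is_path_meets_sphere]. Write [q] for either [p] or [x].

    Along the given path from [p] to [x], the distance to [f q] of the image
    under [f] takes the values [0] and [mdist (f x) (f p)] at the endpoints,
    in one order or the other, hence every value [eps] in between
    ([is_path_IVT]): the preimage of the sphere of radius [eps] around [f q]
    is nonempty. The infimum [delta_of f q eps] is therefore a genuine one,
    and it is positive because continuity at [q] keeps that preimage away from
    [q] ([delta_of_gt0]).

    If some [z] in the ball of radius [delta_of f q eps] around [q] had an
    image at distance at least [eps] from [f q], then a path from [q] to [z]
    inside the ball would contain a point of the preimage of the sphere, which
    is closer to [q] than the infimum of all such distances: a contradiction
    ([path_connected_delta_epsilon]). *)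

Lemma mdist_continuous (R : realType) (Y : metricType R) (y0 : Y) :
  continuous (mdist y0 : Y -> R).
Proof.
move=> y; apply/cvgrPdist_lt => e e0.
have : \forall y' \near y, mdist y y' < e.
  by apply: metricType_numDomainType.cvgr_dist_lt e0; exact: cvg_id.
apply: filterS => y' /= yy'.
rewrite (le_lt_trans _ yy')// ler_norml lerNl opprB !lerBlDr addrC.
rewrite metric_triangle/= (metric_sym y) addrC.
exact: metric_triangle.
Qed.

Lemma is_path_IVT (R : realType) (X : topologicalType) (phi : X -> R)
    (a b : X) (g : R -> X) (v : R) :
  continuous phi -> is_path a b g ->
  Num.min (phi a) (phi b) <= v <= Num.max (phi a) (phi b) ->
  exists2 w, (g @` `[0, 1]) w & phi w = v.
Proof.
move=> cphi [cg g0 g1]; rewrite -g0 -g1 => hv.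
have cphig : {within `[0, 1], continuous (phi \o g)}.
  by apply: within_continuous_comp => // w _; exact: cphi.
have [c c01 cv] := IVT (@ler01 R) cphig hv.
by exists (g c) => //; exists c.
Qed.

(** The form in which the intermediate value theorem is used; [q] may be either
    endpoint, so that paths need not be reversed. *)
Lemma is_path_meets_sphere (R : realType) (X Y : metricType R) (f : X -> Y)
    (a b q : X) (g : R -> X) (eps : R) :
  continuous f -> is_path a b g -> q = a \/ q = b ->
  0 <= eps -> eps <= mdist (f a) (f b) ->
  exists2 w, (g @` `[0, 1]) w & (f @^-1` metric_sphere (f q) eps) w.
Proof.
move=> cf gab qab eps0 le_eps.
apply: (is_path_IVT _ _ (mdist (f q) \o f) _ _ _ _ _ gab) => /=.
  by move=> w; apply: continuous_comp; [exact: cf|exact: mdist_continuous].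
rewrite ge_min le_max.
by case: qab => ->; rewrite mdistxx eps0 ?(metric_sym (f b)) le_eps ?orbT.
Qed.

Lemma dist_to_set_le (R : realType) (X : metricType R) (q z : X) (A : set X) :
  A z -> dist_to_set q A <= mdist q z.
Proof.
move=> Az; apply: ge_inf; last by exists z.
by exists 0 => _ [w _ <-]; exact: mdist_ge0.
Qed.

Lemma delta_of_gt0 (R : realType) (X Y : metricType R) (f : X -> Y) (q : X)
    (eps : R) :
  {for q, continuous f} -> 0 < eps ->
  f @^-1` metric_sphere (f q) eps !=set0 -> 0 < delta_of f q eps.
Proof.
move=> cf eps0 [z0 z0eps].
have : \forall z \near q, mdist (f q) (f z) < eps.
  by apply: metricType_numDomainType.cvgr_dist_lt eps0; exact: cf.
move=> /metricType_numDomainType.nbhs_mdistP[r /= r0 rP].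
apply: (lt_le_trans r0); apply: lb_le_inf; first by exists (mdist q z0), z0.
move=> _ [z zeps <-]; rewrite leNgt; apply/negP => /rP/=.
by rewrite zeps ltxx.
Qed.

(** Only nonemptiness of the preimage of the sphere and path-connectedness of
    the one ball matter. *)
Lemma path_connected_delta_epsilon (R : realType) (X Y : metricType R)
    (f : X -> Y) (q : X) (eps : R) :
  continuous f -> 0 < eps ->
  f @^-1` metric_sphere (f q) eps !=set0 ->
  path_connected R (ball q (delta_of f q eps)) ->
  is_delta_epsilon f q eps (delta_of f q eps).
Proof.
move=> cf eps0 sphere0 ballpc.
have delta0 : 0 < delta_of f q eps by apply: delta_of_gt0 => //; exact: cf.
split=> // z zq; rewrite ltNge; apply/negP => le_eps.
have [||g gqz gball] := ballpc q z.
- by rewrite ballEmdist/= mdistxx.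
- by rewrite ballEmdist/= metric_sym.
have [|w /gball wball weps] :=
    is_path_meets_sphere _ _ _ f q z q g eps cf gqz (or_introl erefl) (ltW eps0).
  by rewrite metric_sym.
move: wball; rewrite ballEmdist/= ltNge => /negP; apply.
exact: dist_to_set_le.
Qed.

Theorem corollary2 (R : realType) (X Y : metricType R) (f : X -> Y)
  (hf : continuous f) (p x : X)
  (hbeta : 0 < mdist (f x) (f p))
  (hpath : exists g : R -> X, is_path p x g)
  (hballs : forall eps : R, 0 < eps -> eps <= mdist (f x) (f p) ->
    path_connected R (ball p (delta_of f p eps)) /\
    path_connected R (ball x (delta_of f x eps))) :
  forall eps : R, 0 < eps -> eps <= mdist (f x) (f p) ->
    is_delta_epsilon f p eps (delta_of f p eps) /\
    is_delta_epsilon f x eps (delta_of f x eps).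
Proof.
move=> eps eps0 le_eps; have [ballp ballx] := hballs eps eps0 le_eps.
have [g gpx] := hpath.
have meets q : q = p \/ q = x -> f @^-1` metric_sphere (f q) eps !=set0.
  move=> qpx.
  have [|w _ weps] := is_path_meets_sphere _ _ _ f p x q g eps hf gpx qpx (ltW eps0).
    by rewrite metric_sym.
  by exists w.
by split; apply: path_connected_delta_epsilon => //; apply: meets; [left|right].
Qed.
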